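(* Let $X$ be a geodesic space with the betweenness property and $C$ a nonempty and convex subset of $X$. Suppose $T_\lambda : C \to C$ is an averaged mapping. Then any periodic point of $T_\lambda$ is a fixed point of $T_\lambda$.
   Context: A geodesic path from $x$ to $y$ in a metric space $(X,d)$ is a map $c:[0,l]\to X$ with $c(0)=x$, $c(l)=y$ and $d(c(t),c(t'))=|t-t'|$ for all $t,t'\in[0,l]$; its image is a geodesic segment joining $x$ and $y$. $X$ is a geodesic space if any two points are joined by a geodesic path (not necessarily unique). $C\subseteq X$ is convex if it contains any geodesic segment joining any two of its points. A point $y$ lies between two distinct points $x$ and $z$ if $y$ is distinct from $x$ and $z$ and $d(x,z)=d(x,y)+d(y,z)$. $X$ satisfies the betweenness property if for every four pairwise distinct points $x,y,z,w\in X$, if $y$ lies between $x$ and $z$ and $z$ lies between $y$ and $w$, then $y$ and $z$ both lie between $x$ and $w$. Averaged mapping: given $\lambda\in(0,1)$ and a nonexpansive ($1$-Lipschitz) $T:C\to C$, $T_\lambda:C\to C$ is defined by $T_\lambda x=(1-\lambda)x+\lambda Tx$, the point at distance $\lambda d(x,Tx)$ from $x$ on a geodesic segment joining $x$ and $Tx$; if segments are not unique, one fixed segment is chosen for each pair of points (by a convexity mapping assigning to each two points exactly one geodesic segment joining them). A periodic point of $T_\lambda$ is a point $x$ with $T_\lambda^{n}x=x$ for some $n\ge1$. *)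

(* Defs.v *)
From HB Require Import structures.
From mathcomp Require Import all_boot all_order all_algebra.
From mathcomp Require Import all_classical all_reals topology.

Set Implicit Arguments.
Unset Strict Implicit.
Unset Printing Implicit Defensive.

Import Order.TTheory GRing.Theory Num.Theory.

Local Open Scope classical_set_scope.
Local Open Scope ring_scope.

Section Geodesics.
Context {R : realType} {X : metricType R}.
Implicit Types (x y z w : X) (S C : set X).

(* Only the restriction of c to [0, l] matters. *)
Definition geodesic_path x y (l : R) (c : R -> X) : Prop :=
  [/\ 0 <= l, c 0 = x, c l = y &
      {in `[0, l] &, forall t t', mdist (c t) (c t') = `|t - t'|}].

Definition geodesic_segment x y S : Prop :=
  exists l c, geodesic_path x y l c /\ S = c @` `[0, l].

Definition geodesically_convex C : Prop :=
  forall x y, C x -> C y -> forall S, geodesic_segment x y S -> S `<=` C.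

(* y lies between the distinct points x and z *)
Definition between x y z : Prop :=
  [/\ x <> z, y <> x, y <> z & mdist x z = mdist x y + mdist y z].

(* seg x y and seg y x are not required to be the same segment: the choice of
   one segment for each unordered pair of points is the special case
   seg x y = seg y x. *)
Definition convexity_mapping (seg : X -> X -> set X) : Prop :=
  forall x y, geodesic_segment x y (seg x y).

(* (1 - lam) x + lam y: for lam in [0, 1], there is exactly one such point on
   the segment (see cvx_combP and cvx_comb_unique), so that the default value x
   is never used. *)
Definition cvx_comb (seg : X -> X -> set X) (lam : R) x y : X :=
  xget x [set z | seg x y z /\ mdist x z = lam * mdist x y].

Definition averaged (seg : X -> X -> set X) (lam : R) (T : X -> X) x : X :=
  cvx_comb seg lam x (T x).

Definition nonexpansive_on C (T : X -> X) : Prop :=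
  forall x y, C x -> C y -> mdist (T x) (T y) <= mdist x y.

Definition periodic_point (f : X -> X) x : Prop :=
  exists2 n : nat, (1 <= n)%N & iter n f x = x.

Lemma geodesic_path_dist x y l c t : geodesic_path x y l c ->
  t \in `[0, l] -> mdist x (c t) = t.
Proof.
move=> [l0 <- _ cd] tl; have in0 : 0 \in `[0, l] by rewrite in_itv/= lexx.
rewrite cd// sub0r normrN ger0_norm//.
by move: tl; rewrite in_itv/= => /andP[].
Qed.

Lemma cvx_combP seg lam x y : convexity_mapping seg -> 0 <= lam <= 1 ->
  seg x y (cvx_comb seg lam x y) /\
  mdist x (cvx_comb seg lam x y) = lam * mdist x y.
Proof.
move=> /(_ x y) [l [c [cP segE]]] /andP[lam0 lam1].
have [l0 _ cl _] := cP.
have inl : l \in `[0, l] by rewrite in_itv/= lexx l0.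
have inm : lam * l \in `[0, l] by rewrite in_itv/= mulr_ge0//= ler_piMl.
have dl : mdist x y = l by rewrite -cl (geodesic_path_dist cP).
apply: (@xgetPex _ x [set z | seg x y z /\ mdist x z = lam * mdist x y]).
exists (c (lam * l)); split; first by rewrite segE; exists (lam * l).
by rewrite dl (geodesic_path_dist cP).
Qed.

Lemma cvx_comb_unique seg lam x y z : convexity_mapping seg ->
  seg x y z -> mdist x z = lam * mdist x y -> z = cvx_comb seg lam x y.
Proof.
move=> segP sz dz; apply/esym; apply: xget_subset1 => //= u v [su du] [sv dv].
have [l [c [cP segE]]] := segP x y.
move: su sv du dv; rewrite segE => -[s /= sl <-] [t /= tl <-].
by rewrite !(geodesic_path_dist cP)// => -> ->.
Qed.

End Geodesics.

Definition geodesic_space {R : realType} (X : metricType R) : Prop :=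
  forall x y : X, exists l c, geodesic_path x y l c.

Definition betweenness_property {R : realType} (X : metricType R) : Prop :=
  forall x y z w : X,
    x <> y -> x <> z -> x <> w -> y <> z -> y <> w -> z <> w ->
    between x y z -> between y z w -> between x y w /\ between x z w.

(* Main.v *)
Require Import Defs.
From HB Require Import structures.
From mathcomp Require Import all_boot all_order all_algebra.
From mathcomp Require Import all_classical all_reals topology.
From mathcomp Require Import lra.

Import Order.TTheory GRing.Theory Num.Theory.

Local Open Scope classical_set_scope.
Local Open Scope ring_scope.

(** Let [x_k] be the orbit of [x] under the averaged mapping. Nonexpansiveness
    gives [d (x_(k+1), T x_(k+1)) <= d (x_k, T x_k)]; along a periodic orbit
    this nonincreasing displacement is constant, say [r], so the triangle
    inequalities behind it are equalities: [T x_k] lies metrically between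
    [x_(k+1)] and [T x_(k+1)]. If [r > 0], the betweenness property applied to
    [x_k, x_(k+1), T x_k, T x_(k+1)] puts [x_(k+1)] between [x_k] and
    [T x_(k+1)], hence between [x_k] and [x_(k+2)], a point of the segment from
    [x_(k+1)] to [T x_(k+1)] (lemma [dist_averaged_averaged]). Betweenness propagates this
    local alignment to the whole orbit, [d (x_0, x_n) = n * lam * r] (lemma
    [dist_aligned_sequence]), so that the orbit never returns to [x_0]. Hence
    [r = 0] and [x] is fixed. *)

Section Metric.
Set Implicit Arguments.
Unset Strict Implicit.
Context {R : realType} {X : metricType R}.
Implicit Types (x y z w : X) (S : set X).

Lemma geodesic_segment_dist x y z S : geodesic_segment x y S -> S z ->
  mdist x y = mdist x z + mdist z y.
Proof.
move=> [l [c [cP ->]]] [t tl <-]; rewrite (geodesic_path_dist cP tl).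
have [l0 c0 cl cd] := cP.
have inl : l \in `[0, l] by rewrite in_itv/= lexx l0.
move: (tl); rewrite /= in_itv/= => /andP[_ tl1].
rewrite -cl (geodesic_path_dist cP inl) cd// distrC ger0_norm ?subr_ge0//.
by rewrite addrC subrK.
Qed.

Lemma between_dist x y z : 0 < mdist x y -> 0 < mdist y z ->
  mdist x z = mdist x y + mdist y z -> between x y z.
Proof.
move=> xy yz xz; split=> // e; move: xy yz xz; rewrite ?e ?mdistxx; lra.
Qed.

(** The betweenness property in additive form: among its distinctness
    conditions, only [x <> w] does not follow from the positive distances. *)
Lemma betweenness_dist x y z w : betweenness_property X -> x <> w ->
  0 < mdist x y -> 0 < mdist y z -> 0 < mdist z w ->
  mdist x z = mdist x y + mdist y z -> mdist y w = mdist y z + mdist z w ->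
  mdist x w = mdist x y + mdist y z + mdist z w.
Proof.
move=> btw xw xy yz zw xz yw.
have B1 := between_dist xy yz xz; have B2 := between_dist yz zw yw.
have [nxz nyx nyz _] := B1; have [nyw nzy nzw _] := B2.
have [[_ _ _ ->] _] := btw x y z w (nesym nyx) nxz xw nyz nyw nzw B1 B2.
by rewrite yw addrA.
Qed.

(** A sequence with constant step [s > 0], any three consecutive terms of which
    are aligned, advances along a geodesic. *)
Lemma dist_aligned_sequence (u : nat -> X) (s : R) : betweenness_property X ->
  0 < s -> (forall k, mdist (u k) (u k.+1) = s) ->
  (forall k, mdist (u k) (u k.+2) = s + s) ->
  forall m, mdist (u 0%N) (u m) = m%:R * s.
Proof.
move=> btw s0 u1 u2 m.
suff [] : mdist (u 0%N) (u m) = m%:R * s /\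
          mdist (u 0%N) (u m.+1) = m.+1%:R * s by [].
elim: m => [|[|m] [IH1 IH2]].
- by rewrite mdistxx u1 mul0r mul1r.
- by rewrite u1 u2 mul1r mulr_natl.
- split=> //; have m0 : 0 <= m%:R * s by rewrite mulr_ge0// ltW.
  move: IH1 IH2; rewrite -!natr1 !mulrDl !mul1r => IH1 IH2.
  have u0 : u 0%N <> u m.+3.
    (* u m.+2 is at distance (m + 2) s from u 0, but s from u m.+3 *)
    by move=> e; have := u1 m.+2; rewrite -e metric_sym IH2; lra.
  by rewrite (@betweenness_dist _ (u m.+1) (u m.+2) _ btw u0) ?u1 ?u2 ?IH1 ?IH2//;
    lra.
Qed.

End Metric.

Section Averaged.
Set Implicit Arguments.
Unset Strict Implicit.
Context {R : realType} {X : metricType R}.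
Variables (C : set X) (seg : X -> X -> set X) (T : X -> X) (lam : R).
Hypotheses (cvxC : geodesically_convex C) (segP : convexity_mapping seg).
Hypotheses (TC : set_fun C C T) (neT : nonexpansive_on C T).
Hypotheses (lam0 : 0 < lam) (lam1 : lam < 1).

Local Notation f := (averaged seg lam T).

Let lam01 : 0 <= lam <= 1. Proof. by rewrite !ltW. Qed.

Lemma averaged_in x : C x -> C (f x).
Proof.
move=> Cx; have [sf _] := cvx_combP x (T x) segP lam01.
exact: (cvxC Cx (TC Cx) (segP x (T x)) sf).
Qed.

Lemma dist_averaged x : mdist x (f x) = lam * mdist x (T x).
Proof. by have [] := cvx_combP x (T x) segP lam01. Qed.

Lemma dist_averaged_split x : mdist x (T x) = mdist x (f x) + mdist (f x) (T x).
Proof.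
have [sf _] := cvx_combP x (T x) segP lam01.
exact: geodesic_segment_dist (segP x (T x)) sf.
Qed.

Lemma displacement_averaged_le x : C x ->
  mdist (f x) (T (f x)) <= mdist x (T x).
Proof.
move=> Cx; rewrite (dist_averaged_split x).
have := neT Cx (averaged_in Cx).
have := metric_triangle (f x) (T x) (T (f x)); lra.
Qed.

(** When the displacement does not drop at [x], the points [x], [f x] and
    [f (f x)] are aligned. *)
Lemma dist_averaged_averaged x : betweenness_property X -> C x ->
  0 < mdist x (T x) -> mdist (f x) (T (f x)) = mdist x (T x) ->
  mdist x (f (f x)) = mdist x (f x) + mdist (f x) (f (f x)).
Proof.
move=> btw Cx r0 rE.
have ne := neT Cx (averaged_in Cx).
have tri := metric_triangle (f x) (T x) (T (f x)).
have spl := dist_averaged_split x.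
have dx := dist_averaged x.
have lr0 : 0 < lam * mdist x (T x) by rewrite mulr_gt0.
have lr1 : lam * mdist x (T x) < mdist x (T x) by rewrite gtr_pMl.
(* equality in the chain of inequalities of displacement_averaged_le *)
have step : mdist (T x) (T (f x)) = mdist x (f x) by lra.
have xT : x <> T (f x).
  (* otherwise d (f x, x) would be both r and lam * r, where r = d (x, T x) *)
  by move=> e; move: rE; rewrite -e metric_sym; lra.
have := @betweenness_dist _ _ x (f x) (T x) (T (f x)) btw xT.
have spl' := dist_averaged_split (f x).
have tri1 := metric_triangle x (f (f x)) (T (f x)).
have tri2 := metric_triangle x (f x) (f (f x)).
by move=> B; have := B ltac:(lra) ltac:(lra) ltac:(lra) ltac:(lra) ltac:(lra); lra.
Qed.

End Averaged.

Theorem proposition3p1 (R : realType) (X : metricType R)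
    (geoX : geodesic_space X) (btwX : betweenness_property X)
    (C : set X) (C0 : C !=set0) (cvxC : geodesically_convex C)
    (seg : X -> X -> set X) (segP : convexity_mapping seg)
    (T : X -> X) (TC : set_fun C C T) (neT : nonexpansive_on C T)
    (lam : R) (lam0 : 0 < lam) (lam1 : lam < 1)
    (x : X) (Cx : C x) (px : periodic_point (averaged seg lam T) x) :
  averaged seg lam T x = x.
Proof.
case: px => n n1 xn; set f := averaged seg lam T in xn *.
pose u k := iter k f x; pose D k := mdist (u k) (T (u k)).
have Cu k : C (u k).
  by elim: k => // k IH; apply: (averaged_in cvxC segP TC lam0 lam1 IH).
have Dle k : D k.+1 <= D k.
  exact: (displacement_averaged_le cvxC segP TC neT lam0 lam1 (Cu k)).
have Dmono : {homo D : i j / (i <= j)%N >-> j <= i}.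
  by apply: homo_leq => // a b c ba cb; exact: le_trans cb ba.
have uper k : u (k + n)%N = u k by rewrite /u iterD xn.
(* D (k + n) = D k sandwiches D k.+1 because n >= 1 *)
have Dconst k : D k.+1 = D k.
  apply/eqP; rewrite eq_le Dle /=.
  have <- : D (k + n)%N = D k by rewrite /D uper.
  by apply: Dmono; rewrite -addn1 leq_add2l.
have D0 k : D k = D 0%N by elim: k => // k <-.
have := mdist_ge0 x (T x); rewrite le_eqVlt => /orP[/eqP r0|r0].
  apply/esym/mdist_positivity.
  by rewrite (dist_averaged T segP lam0 lam1) -r0 mulr0.
have u1 k : mdist (u k) (u k.+1) = lam * D 0%N.
  by rewrite (dist_averaged T segP lam0 lam1) -(D0 k).
have u2 k : mdist (u k) (u k.+2) = lam * D 0%N + lam * D 0%N.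
  rewrite (dist_averaged_averaged cvxC segP TC neT lam0 lam1 btwX (Cu k)).
  - by rewrite -{1}(u1 k) -(u1 k.+1).
  - by rewrite -/(D k) D0.
  - exact: Dconst.
have s0 : 0 < lam * D 0%N by rewrite mulr_gt0.
have := dist_aligned_sequence btwX s0 u1 u2 n.
rewrite (_ : u n = u 0%N) ?mdistxx; last exact: (uper 0%N).
move=> /esym/eqP.
by rewrite mulf_eq0 pnatr_eq0 (gt_eqF s0) orbF -leqn0 leqNgt n1.
Qed.
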